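(* Let $(X,\tau,g)$ be a first countable premetric space. Suppose that every set-valued map $T:X\rightrightarrows X$ for which there exists a proper, lower semicontinuous and bounded below function $f:X\to\mathbb{R}\cup\{+\infty\}$ such that $$\text{for any }x\in X\text{ there exists }y\in T(x)\text{ with } g(y,x)\le f(x)-f(y),$$ has a fixed point (i.e. a point $\bar x\in X$ with $\bar x\in T(\bar x)$). Then $(X,\tau,g)$ is $\Sigma_g$-semicomplete.
   Context: $\mathbb{R}^+=[0,\infty)$. A premetric space $(X,\tau,g)$ is a first countable topological space $(X,\tau)$ with a premetric function $g:X\times X\to\mathbb{R}^+$, i.e. (P1) $g(x,x)=0$ for all $x\in X$ and $g(x,y)>0$ whenever $x\neq y$; (P2) $g(x,\cdot)$ is continuous for every fixed $x\in X$. (No symmetry or triangle inequality is assumed.) A sequence $\{x_n\}_{n\ge0}$ in $X$ is $\Sigma_g$-Cauchy if its $g$-length $\sum_{i=0}^\infty g(x_{i+1},x_i)$ is finite. $(X,\tau,g)$ is called $\Sigma_g$-semicomplete if every $\Sigma_g$-Cauchy sequence in $X$ has a convergent subsequence. A set-valued map $T:X\rightrightarrows X$ assigns to each $x$ a subset $T(x)\subset X$. Proper means $f$ is not identically $+\infty$. If $f(x)=+\infty$ and $f(y)<+\infty$, then $f(x)-f(y)=+\infty$. *)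

(* Defs.v *)
From HB Require Import structures.
From mathcomp Require Export all_boot all_order all_algebra.
From mathcomp Require Export all_classical all_reals all_analysis.
Export Order.TTheory GRing.Theory Num.Theory.
Export numFieldNormedType.Exports.
Set Implicit Arguments.
Unset Strict Implicit.
Unset Printing Implicit Defensive.

Local Open Scope classical_set_scope.
Local Open Scope ring_scope.

Definition first_countable (X : topologicalType) : Prop :=
  forall x : X, exists2 B : set (set X),
    countable B & B `<=` nbhs x /\
                  (forall U, nbhs x U -> exists2 V, B V & V `<=` U).

Definition premetric (R : realType) (X : topologicalType) (g : X -> X -> R) : Prop :=
  [/\ forall x y, 0 <= g x y,
      forall x, g x x = 0,
      forall x y, x != y -> 0 < g x y &
      forall x, continuous (g x)].

Definition g_length (R : realType) (X : Type) (g : X -> X -> R) (u : nat -> X)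
    : \bar R :=
  (\sum_(0 <= i <oo) (g (u i.+1) (u i))%:E)%E.

Definition Sigma_Cauchy (R : realType) (X : Type) (g : X -> X -> R) (u : nat -> X)
    : Prop :=
  (g_length g u < +oo)%E.

Definition Sigma_semicomplete (R : realType) (X : topologicalType)
    (g : X -> X -> R) : Prop :=
  forall u : nat -> X, Sigma_Cauchy g u ->
    exists phi : nat -> nat, increasing_seq phi /\
      exists l : X, (u \o phi) n @[n --> \oo] --> l.

Definition proper_fun (R : realType) (X : Type) (f : X -> \bar R) : Prop :=
  exists x, f x != +oo%E.

Definition bounded_below (R : realType) (X : Type) (f : X -> \bar R) : Prop :=
  exists m : R, forall x, (m%:E <= f x)%E.

(* Functions X -> R \cup {+oo} are the maps into \bar R avoiding -oo.
   The difference f x - f y is only given a meaning when f y < +oo (it is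
   +oo if f x = +oo), so f y < +oo is part of the condition. *)
Definition Caristi_map (R : realType) (X : topologicalType) (g : X -> X -> R)
    (T : X -> set X) : Prop :=
  exists f : X -> \bar R,
    [/\ forall x, f x != -oo%E,
        proper_fun f, lower_semicontinuous f, bounded_below f &
        forall x, exists y,
          [/\ T x y, (f y < +oo)%E & ((g y x)%:E <= f x - f y)%E]].

Definition has_fixed_point (X : Type) (T : X -> set X) : Prop :=
  exists x, T x x.

(* Main.v *)
Require Import Defs.

Local Open Scope classical_set_scope.
Local Open Scope ring_scope.

(** A Sigma_g-Cauchy sequence [u] without convergent subsequence takes each of
    its values finitely often, and every point has a neighbourhood containing
    no term of [u] other than possibly itself.  Hence the function sending
    [x] to the length of the tail of [u] starting at its last visit to [x], and to
    [+oo] off the range of [u], is lower semicontinuous.  It makes the map that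
    sends [x] to the term following the last visit of [u] to [x] (and to [u 0]
    off the range) a Caristi map, although this map has no fixed point. *)

(** The finite intersections [W n] of an enumerated local base decrease; [phi] picks each next index
    beyond the previous one, with its term in [W n]. *)
Lemma first_countable_cluster_subseq (X : topologicalType)
    (hX : first_countable X) (u : nat -> X) (x : X) :
  (forall V M, nbhs x V -> exists2 n, (M <= n)%N & V (u n)) ->
  exists2 phi : nat -> nat, increasing_seq phi & (u \o phi) n @[n --> \oo] --> x.
Proof.
move=> ux; have [B cB [Bx Bbasis]] := hX x.
have [B0|[h]] : B = set0 \/ $|{surjfun [set: nat] >-> B}| by apply/pfcard_geP.
  by have [V] := Bbasis _ filterT; rewrite B0.
pose W n := \big[setI/setT]_(i < n.+1) h i.
have Wx n : nbhs x (W n).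
  apply: big_ind; [exact: filterT|by move=> ? ?; exact: filterI|move=> i _].
  exact/Bx/funS.
have /choice[s sP] : forall p : nat * nat, exists k, (p.2 < k)%N /\ W p.1 (u k).
  by move=> [n m]; have [k mk Wk] := ux _ m.+1 (Wx n); exists k.
pose phi := fix phi n := if n is m.+1 then s (n, phi m) else s (0%N, 0%N).
have phiW n : W n (u (phi n)) by case: n => [|n]; exact: (sP (_, _)).2.
exists phi.
  by apply/increasing_seqP => n; exact: (sP (n.+1, phi n)).1.
move=> U /Bbasis[V BV VU].
have [i _ hiV] : (h @` setT) V by exact: surj.
exists i => // n /= ilen; apply: VU; rewrite -hiV.
by have := phiW n; rewrite /W -bigcap_mkord; apply; exact: ilen.
Qed.

Lemma last_visit (X : Type) (u : nat -> X) (x : X) (M : nat) :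
  (exists n, u n = x) -> (forall n, (M <= n)%N -> u n <> x) ->
  exists N, u N = x /\ forall n, (N < n)%N -> u n <> x.
Proof.
move=> [n unx] Mx.
have xP : exists n, `[< u n = x >] by exists n; exact/asboolP.
have leM k : `[< u k = x >] -> (k <= M)%N.
  by move=> /asboolP ukx; rewrite leqNgt; apply/negP => /ltnW/Mx.
case: (ex_maxnP xP leM) => N /asboolP uN maxN; exists N; split => // k Nk ukx.
by have := maxN k (asboolT ukx); rewrite leqNgt Nk.
Qed.

(** Continuity of [g x] replaces a separation axiom: if [u M != x], then [g x y < g x (u M)] holds
    near [x] and fails at [u M]. Finitely many such neighbourhoods are intersected. *)
Lemma premetric_nbhs_avoid (R : realType) (X : topologicalType) (g : X -> X -> R)
    (hg : premetric g) (x : X) (u : nat -> X) (M : nat) :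
  \forall y \near x, forall n, (n < M)%N -> u n = y -> y = x.
Proof.
case: hg => _ g0 gpos gcont; elim: M => [|M IH]; first exact: filterE.
have uMx : \forall y \near x, u M = y -> y = x.
  have [->|uMx] := eqVneq (u M) x; first exact: filterE.
  have lt0 : g x x < g x (u M) by rewrite g0 gpos// eq_sym.
  have near_lt : \forall y \near x, g x y < g x (u M).
    exact: (gcont x x _ (lt_nbhsl lt0)).
  by apply: filterS near_lt => y /= + uMy; rewrite uMy ltxx.
apply: filterS2 IH uMx => y IH uMy n; rewrite ltnS leq_eqVlt => /predU1P[->//|].
exact: IH.
Qed.

Theorem theorem3p6 (R : realType) (X : topologicalType) (g : X -> X -> R)
    (hX : first_countable X) (hg : premetric g)
    (hfix : forall T : X -> set X, Caristi_map g T -> has_fixed_point T) :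
  Sigma_semicomplete g.
Proof.
move=> u uC; apply: contrapT => nosub.
have [gge0 _ _ _] := hg.
have away (x : X) : exists (V : set X) (M : nat),
    nbhs x V /\ forall n, (M <= n)%N -> ~ V (u n).
  apply: contrapT => nex; apply: nosub.
  have [|phi phi_incr cphi] := first_countable_cluster_subseq _ hX u x.
    move=> V M Vx; apply: contrapT => nV; apply: nex; exists V, M; split => //.
    by move=> n Mn Vun; apply: nV; exists n.
  by exists phi; split => //; exists x.
(* Off the range of [u], [N x] is a junk value. *)
have /choice[N NP] : forall x, exists N, (exists n, u n = x) ->
    u N = x /\ forall n, (N < n)%N -> u n <> x.
  move=> x; have [xu|] := pselect (exists n, u n = x); last by exists 0%N.
  have [V [M [Vx VM]]] := away x.
  have [n Mn unx|N ?] := last_visit _ u x M xu; last by exists N.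
  by apply: (VM n Mn); rewrite unx; exact: nbhs_singleton.
pose G i := (g (u i.+1) (u i))%:E.
have G0 i : (0 <= G i)%E by rewrite lee_fin.
pose tail n := (\sum_(n <= i <oo) G i)%E.
have tail0 n : (0 <= tail n)%E by apply: nneseries_ge0.
have tail_le m n : (m <= n)%N -> (tail n <= tail m)%E.
  move=> /subnKC <-; rewrite /tail [leRHS](nneseries_split m (n - m))//.
  by rewrite leeDr// sume_ge0.
have tailS n : tail n = (G n + tail n.+1)%E.
  by rewrite /tail (nneseries_split n 1)// addn1 big_nat1.
have tailoo n : (tail n < +oo)%E by apply: le_lt_trans uC; exact: tail_le.
pose f x : \bar R := if `[< exists n, u n = x >] then tail (N x) else +oo%E.
have fu n : f (u n) = tail (N (u n)).
  by rewrite /f asboolT//; exists n.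
have f0 x : (0 <= f x)%E by rewrite /f; case: ifP.
pose T x : set X :=
  [set y | y = if `[< exists n, u n = x >] then u (N x).+1 else u 0%N].
have [|x] := hfix T; last first.
  (* A fixed point off the range would equal [u 0]; one in the range would be visited again after
     its last visit. *)
  rewrite /T/=; case: asboolP => xu xE; last by apply: xu; exists 0%N.
  by have [_ /(_ _ (ltnSn _))] := NP x xu; rewrite -xE.
exists f; split.
- by move=> x; rewrite gt_eqF// (lt_le_trans _ (f0 x)).
- by exists (u 0%N); rewrite fu lt_eqF.
- move=> x a ax; have [V [M [Vx VM]]] := away x.
  (* [V] excludes the terms of index at least [M], the second set the earlier ones other than [x].
     So at any [y <> x] in this neighbourhood, [f] is [+oo]. *)
  exists (V `&` [set y | forall n, (n < M)%N -> u n = y -> y = x]).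
    exact: filterI Vx (premetric_nbhs_avoid _ _ _ hg x u M).
  move=> y [Vy yP]; rewrite /f; case: asboolP => [[n uny]|_]; last exact: ltry.
  have yx : y = x.
    apply: (yP n) => //; rewrite ltnNge; apply/negP => /VM.
    by rewrite uny.
  have xu : exists n, u n = x by exists n; rewrite uny.
  by rewrite yx; move: ax; rewrite /f asboolT.
- by exists 0.
- move=> x; rewrite /T/=; have [xu|xu] := pselect (exists n, u n = x).
    exists (u (N x).+1); rewrite fu /f !asboolT//; split => //.
    have [uNx Nlast] := NP x xu.
    have [|_ Nlast'] := NP (u (N x).+1); first by eexists.
    (* The point [u (N x).+1] is visited at time [(N x).+1], so its last visit is no earlier. Hence
       its tail is at most [tail (N x).+1], and [f] drops by at least [G (N x)]. *)
    have Nlt : (N x < N (u (N x).+1))%N.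
      by rewrite leqNgt; apply/negP => /Nlast'.
    rewrite leeBrDr ?ge0_fin_numE// (tailS (N x)) /G uNx.
    by apply: leeD => //; exact: tail_le.
  exists (u 0%N); rewrite fu /f !asboolF//; split => //.
  by rewrite addye ?leey// (eqe_opp _ +oo) lt_eqF.
Qed.
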